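(* Let $\pi_{\boldsymbol\theta}=\mathrm{softmax}(\widetilde{\boldsymbol\beta}^\top\boldsymbol\theta+\mathbf b)$ for $\boldsymbol\theta\in\Delta^{K-1}$, where $\widetilde{\boldsymbol\beta}\in\mathbb R^{K\times|\widetilde{\mathcal V}|}$ and $\mathbf b\in\mathbb R^{|\widetilde{\mathcal V}|}$, and write $\ell_v(\boldsymbol\theta)=(\widetilde{\boldsymbol\beta}^\top\boldsymbol\theta)_v+b_v$ for $v\in\widetilde{\mathcal V}$. Then $$e(\boldsymbol\theta)=\frac{\exp\ell_{\dashv}(\boldsymbol\theta)}{\sum_{v\in\widetilde{\mathcal V}}\exp\ell_v(\boldsymbol\theta)},\qquad \sigma(\boldsymbol\theta)=\frac{\sum_{w\in\mathcal V}\mathrm{syl}(w)\exp\ell_w(\boldsymbol\theta)}{\sum_{v\in\widetilde{\mathcal V}}\exp\ell_v(\boldsymbol\theta)},$$ and the almost sure long-text limit $\Phi(\boldsymbol\theta)$ of $\mathrm{FKGL}_N$ as $N\to\infty$ is given by $$\Phi(\boldsymbol\theta)=a\,\frac{1-e(\boldsymbol\theta)}{e(\boldsymbol\theta)}+b\,\frac{\sigma(\boldsymbol\theta)}{1-e(\boldsymbol\theta)}+c$$ with these $e,\sigma$. The outer form of $\Phi$ as a function of $(e,\sigma)$ is thus the same as for admixture models, but $e$ and $\sigma$ are no longer linear in $\boldsymbol\theta$, so the admixture formula $$\Phi(\boldsymbol\theta)=a\,\frac{1-\mathbf q^\top\boldsymbol\theta}{\mathbf q^\top\boldsymbol\theta}+b\,\frac{\mathbf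 s^\top\boldsymbol\theta}{1-\mathbf q^\top\boldsymbol\theta}+c,$$ in which $e(\boldsymbol\theta)=\mathbf q^\top\boldsymbol\theta$ and $\sigma(\boldsymbol\theta)=\mathbf s^\top\boldsymbol\theta$, does not apply.
   Context: $\mathcal V$ is a finite word vocabulary, $\dashv$ is a sentence-boundary token, and $\widetilde{\mathcal V}=\mathcal V\cup\{\dashv\}$. $\mathrm{syl}:\mathcal V\to[1,s_{\max}]$ is a fixed bounded real-valued syllable count, extended by $\mathrm{syl}(\dashv)=0$. $\Delta^{K-1}$ is the probability simplex in $\mathbb R^K$. For any map $\boldsymbol\theta\mapsto\pi_{\boldsymbol\theta}$ from $\Delta^{K-1}$ to probability distributions on $\widetilde{\mathcal V}$, define $e(\boldsymbol\theta)=\pi_{\boldsymbol\theta}(\dashv)$ and $\sigma(\boldsymbol\theta)=\sum_{w\in\mathcal V}\pi_{\boldsymbol\theta}(w)\,\mathrm{syl}(w)$. For tokens $v_1,v_2,\dots$ i.i.d. from $\pi_{\boldsymbol\theta}$ given $\boldsymbol\theta$, let $S_N=\sum_{n\le N}\mathbf 1[v_n=\dashv]$, $W_N=N-S_N$, $Y_N=\sum_{n\le N}\mathrm{syl}(v_n)$, and $\mathrm{FKGL}_N=a\,W_N/S_N+b\,Y_N/W_N+c$ (with an arbitrary fixed value when $S_N=0$ or $W_N=0$). The coefficients $(a,b,c)$ are fixed: $(0.39,11.8,-15.59)$ (Flesch–Kincaid Grade Level) or $(-1.015,-84.6,206.835)$ (Flesch Reading Ease); the scalar $b$ is unrelated to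 the vector $\mathbf b$ and its entries $b_v$. The softmax model above is the product-of-experts model (ProdLDA). By contrast, an admixture model is one with $\pi_{\boldsymbol\theta}=\sum_{k=1}^K\theta_k\boldsymbol\beta_k$ for fixed probability distributions $\boldsymbol\beta_k=(\beta_{kv})_{v\in\widetilde{\mathcal V}}$ on $\widetilde{\mathcal V}$; for it one sets $q_k=\beta_{k\dashv}$, $s_k=\sum_{w\in\mathcal V}\beta_{kw}\,\mathrm{syl}(w)$, $\mathbf q=(q_k)_k$, $\mathbf s=(s_k)_k\in\mathbb R^K$, and the admixture formula for $\Phi$ holds for all $\boldsymbol\theta\in\Delta^{K-1}$ with $0<\mathbf q^\top\boldsymbol\theta<1$.
   Formalization: The word vocabulary is nonempty; non-linearity of e and failure of the admixture formula are stated when π_θ is not constant on the simplex, and non-linearity of σ when σ is not constant, since constant functions (e.g. β̃ = 0 or K = 1) are linear there. *)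

(* Defs.v *)
From HB Require Import structures.
From mathcomp Require Import all_boot all_order all_algebra finmap.
From mathcomp Require Import all_classical all_reals all_analysis.

Set Implicit Arguments.
Unset Strict Implicit.
Unset Printing Implicit Defensive.

Import Order.TTheory GRing.Theory Num.Theory.
Import numFieldNormedType.Exports.

Local Open Scope classical_set_scope.
Local Open Scope ring_scope.

(* [None] is the sentence-boundary token, [Some w] the word [w]. *)
Notation token V := (option V).
Notation eos := None (only parsing).

Definition syl_ext (R : realType) (V : finType) (syl : V -> R)
  (v : token V) : R := if v is Some w then syl w else 0.

(* The two admissible triples: Flesch-Kincaid Grade Level and Flesch Reading
   Ease. *)
Definition readability_coefs (R : realType) (a b c : R) : Prop :=
  (a, b, c) = (39 / 100, 118 / 10, - (1559 / 100)) \/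
  (a, b, c) = (- (1015 / 1000), - (846 / 10), 206 + 835 / 1000).

Definition is_distribution (R : realType) (T : finType) (p : T -> R) : Prop :=
  (forall x, 0 <= p x) /\ \sum_x p x = 1.

Definition simplex (R : realType) (K : nat) : set 'cV[R]_K :=
  [set theta | is_distribution (fun k => theta k 0)].
Arguments simplex : clear implicits.

Definition dotv (R : realType) (K : nat) (q theta : 'cV[R]_K) : R :=
  (q^T *m theta) 0 0.

Definition eos_rate (R : realType) (V : finType) (p : token V -> R) : R :=
  p eos.

Definition syl_rate (R : realType) (V : finType) (syl : V -> R)
  (p : token V -> R) : R := \sum_(w : V) p (Some w) * syl w.

Definition softmax (R : realType) (n : nat) (z : 'cV[R]_n) : 'cV[R]_n :=
  \col_i (expR (z i 0) / \sum_j expR (z j 0)).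

(* Coordinates of R^|token V| are indexed by tokens through [enum_rank]. *)
Definition logit (R : realType) (V : finType) (K : nat)
  (beta : 'M[R]_(K, #|{: token V}|)) (bias : 'cV[R]_(#|{: token V}|))
  (theta : 'cV[R]_K) (v : token V) : R :=
  (beta^T *m theta) (enum_rank v) 0 + bias (enum_rank v) 0.

Definition softmax_model (R : realType) (V : finType) (K : nat)
  (beta : 'M[R]_(K, #|{: token V}|)) (bias : 'cV[R]_(#|{: token V}|))
  (theta : 'cV[R]_K) (v : token V) : R :=
  softmax (beta^T *m theta + bias) (enum_rank v) 0.

Definition admixture_model (R : realType) (V : finType) (K : nat)
  (B : 'I_K -> token V -> R) (theta : 'cV[R]_K) (v : token V) : R :=
  \sum_k theta k 0 * B k v.

Definition admixture_q (R : realType) (V : finType) (K : nat)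
  (B : 'I_K -> token V -> R) : 'cV[R]_K := \col_k B k eos.

Definition admixture_s (R : realType) (V : finType) (syl : V -> R) (K : nat)
  (B : 'I_K -> token V -> R) : 'cV[R]_K :=
  \col_k \sum_(w : V) B k (Some w) * syl w.

(* [T] carries its discrete sigma-algebra; independence is the product rule for
   all finite subfamilies and all events. *)
Definition iid (R : realType) (T : finType) (d : measure_display)
  (Omega : measurableType d) (P : probability Omega R)
  (X : nat -> Omega -> T) (p : T -> R) : Prop :=
  [/\ forall n (A : set T), measurable (X n @^-1` A),
      forall n x, P (X n @^-1` [set x]) = (p x)%:E
    & forall (J : {fset nat}) (A : nat -> set T),
        P (\bigcap_(j in [set` J]) X j @^-1` A j) =
        (\prod_(j <- J) P (X j @^-1` A j))%E].

(* Tokens are numbered from 0, so the first N tokens are v 0, ..., v (N - 1);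
   [dflt] is the value of the score when S_N = 0 or W_N = 0. *)
Definition fkgl (R : realType) (V : finType) (syl : V -> R) (a b c dflt : R)
  (v : nat -> token V) (N : nat) : R :=
  let S : R := \sum_(n < N) (v n == eos)%:R in
  let W := N%:R - S in
  let Y := \sum_(n < N) syl_ext syl (v n) in
  if (S == 0) || (W == 0) then dflt else a * (W / S) + b * (Y / W) + c.

(* [l] is the almost sure limit of the score of i.i.d. tokens of law [p], on
   whatever probability space they are realised. *)
Definition long_text_limit (R : realType) (V : finType) (syl : V -> R)
  (a b c dflt : R) (p : token V -> R) (l : R) : Prop :=
  forall (d : measure_display) (Omega : measurableType d)
    (P : probability Omega R) (v : nat -> Omega -> token V),
    iid P v p ->
    {ae P, forall omega,
       (fun N => fkgl syl a b c dflt (fun n => v n omega) N) @ \oo --> l}.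

(* The outer form of the long-text limit, as a function of (e, sigma). *)
Definition outer_form (R : realType) (a b c e sigma : R) : R :=
  a * ((1 - e) / e) + b * (sigma / (1 - e)) + c.

(* On the simplex the coordinates sum to 1, so this also covers affine
   functions. *)
Definition linear_on_simplex (R : realType) (K : nat) (f : 'cV[R]_K -> R) :
  Prop :=
  exists q : 'cV[R]_K, forall theta, simplex R K theta ->
    f theta = dotv q theta.

Definition nonconstant_on_simplex (R : realType) (K : nat) (T : Type)
  (f : 'cV[R]_K -> T) : Prop :=
  exists theta theta', [/\ simplex R K theta, simplex R K theta'
                         & f theta <> f theta'].

(* [Phi] is given by an admixture formula with coefficient vectors [q], [s],
   at every point where that formula is defined; a formula defined nowhere on
   the simplex is discarded. *)
Definition admixture_formula_applies (R : realType) (a b c : R) (K : nat)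
  (Phi : 'cV[R]_K -> R) : Prop :=
  exists q s : 'cV[R]_K,
    (exists theta, simplex R K theta /\ 0 < dotv q theta < 1) /\
    (forall theta, simplex R K theta -> 0 < dotv q theta < 1 ->
       Phi theta = outer_form a b c (dotv q theta) (dotv s theta)).

(* Main.v *)
(* Almost sure limits: the second moment of a centred empirical count after N
   tokens is at most N, so along N = m^2 the squared deviations of the
   frequencies have summable means and tend to 0 almost surely; the counts vary
   slowly between consecutive squares.

   Failure of the admixture formula: along a segment of the simplex, every odds
   exp (l_w - l_eos) is t |-> exp (al_w + ga_w t), and with H and G the plain
   and syllable-weighted sums of odds, e = 1 / (1 + H), sigma = G / (1 + H) and
   Phi = a H + b G / H + c.  If e, sigma or Phi has the admixture form near one
   end of the segment, an identity between exponential polynomials in t holds on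
   an interval, hence for all real t.  For all real t, however, e and sigma stay
   nonnegative, which no nonconstant affine function does, and Phi grows
   exponentially in one direction as soon as one slope ga_w is nonzero, because
   G / H stays bounded. *)

Require Import Defs.
From HB Require Import structures.
From mathcomp Require Import all_boot all_order all_algebra finmap.
From mathcomp Require Import all_classical all_reals all_analysis.
From mathcomp Require Import zify ring lra.

Set Implicit Arguments.
Unset Strict Implicit.
Unset Printing Implicit Defensive.

Import Order.TTheory GRing.Theory Num.Theory.
Import numFieldNormedType.Exports.

Local Open Scope classical_set_scope.
Local Open Scope ring_scope.

(** * Exponential polynomials: closure properties and the identity principle *)

Section ExponentialPolynomials.
Variable R : realType.
Implicit Types (s : seq ({poly R} * R)) (f g : R -> R).

Definition exppoly s (t : R) : R := \sum_(x <- s) x.1.[t] * expR (x.2 * t).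

Definition exppoly_deriv s := [seq (x.1^`() + x.2 *: x.1, x.2) | x <- s].

Definition exppoly_shift c s := [seq (x.1, x.2 - c) | x <- s].

Lemma exppoly_cons x s t :
  exppoly (x :: s) t = x.1.[t] * expR (x.2 * t) + exppoly s t.
Proof. by rewrite /exppoly big_cons. Qed.

Lemma is_derive_exppoly s t :
  is_derive t (1 : R) (exppoly s) (exppoly (exppoly_deriv s) t).
Proof.
elim: s => [|[p c] s IH] /=.
  rewrite (_ : exppoly [::] = cst 0).
    by rewrite /cst; exact: is_derive_cst.
  by apply/funext => x; rewrite /exppoly big_nil.
rewrite exppoly_cons /=.
have -> : exppoly ((p, c) :: s) =
    (horner p * (expR \o (fun x => c * x))) + exppoly s.
  by apply/funext => x; rewrite exppoly_cons.
apply: is_deriveD.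
have hl : is_derive t (1 : R) (fun x : R => c * x) c.
  have := @is_deriveZ _ R R id c t 1 1 (is_derive_id _ _).
  by rewrite /GRing.scale /= mulr1.
have hexp := is_derive1_comp (is_derive_expR (c * t)) hl.
have := is_deriveM (is_derive_poly p t) hexp.
move/is_derive_eq; apply.
rewrite /GRing.scale /= hornerD hornerZ; ring.
Qed.

Lemma exppoly_shiftE c s t :
  exppoly (exppoly_shift c s) t = expR (- c * t) * exppoly s t.
Proof.
rewrite /exppoly big_map mulr_sumr; apply: eq_bigr => x _ /=.
rewrite mulrBl expRD mulNr; ring.
Qed.

(* Dividing by the first exponential and differentiating lowers the degree of
   its coefficient and does not raise the other ones. *)
Lemma exppoly_eq0 (tau : R) s : 0 < tau ->
  (forall t, 0 < t < tau -> exppoly s t = 0) -> forall t, exppoly s t = 0.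
Proof.
move=> tau0.
(* The successor makes a term count even when its coefficient is 0, so that discarding such a term
   decreases [mu]. *)
pose mu s := (\sum_(x <- s) (size x.1).+1)%N.
have [n] := ubnP (mu s); elim: n s => // n IH [|[p c] s].
  by move=> _ _ t; rewrite /exppoly big_nil.
rewrite /mu big_cons /= -/(mu s) ltnS => le_n s0.
have [p0|p_neq0] := eqVneq p 0.
  have e t : exppoly ((p, c) :: s) t = exppoly s t.
    by rewrite exppoly_cons p0 horner0 mul0r add0r.
  move=> t; rewrite e; apply: IH => [|u /s0]; last by rewrite e.
  by apply: leq_trans le_n; rewrite addSn ltnS leq_addl.
set s1 := exppoly_shift c ((p, c) :: s).
have s1E := exppoly_shiftE c ((p, c) :: s); rewrite -/s1 in s1E.
have d1 t : exppoly (exppoly_deriv s1) t = 0.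
  apply: IH => [|u u01].
    apply: leq_trans le_n.
    rewrite /mu /s1 /= big_cons /= subrr scale0r addr0 -addSn.
    apply: leq_add; first exact: lt_size_deriv.
    rewrite /exppoly_deriv /exppoly_shift !big_map; apply: leq_sum => x _ /=.
    rewrite ltnS (leq_trans (size_polyD _ _)) // geq_max size_scale_leq andbT.
    have [->|/lt_size_deriv/ltnW//] := eqVneq x.1 0.
    by rewrite deriv0 size_poly0.
  have h := is_derive_exppoly s1 u.
  have h0 : is_derive u (1:R) (exppoly s1) 0.
    have hc := @is_derive_cst R R R 0 u 1.
    apply: near_eq_is_derive hc.
    have : u \in `]0, tau[ by rewrite in_itv.
    move/near_in_itvoo; apply: filterS => v; rewrite in_itv /= => v01.
    by rewrite s1E s0 // mulr0.
  by rewrite -(@derive_val _ _ _ _ _ _ _ h) (@derive_val _ _ _ _ _ _ _ h0).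
(* Passage from the interval to the line: the derivative of [s1] vanishes everywhere, so [s1] is
   constant, equal to its value at the interior point [tau / 2]. *)
have cst1 t : exppoly s1 t = 0.
  have -> : exppoly s1 t = exppoly s1 (tau / 2).
    apply: is_derive_0_is_cst => x; rewrite -(d1 x); exact: is_derive_exppoly.
  by rewrite s1E s0 ?mulr0 //; lra.
move=> t; have := cst1 t; rewrite s1E => /eqP; rewrite mulf_eq0.
by rewrite gt_eqF ?expR_gt0 //= => /eqP.
Qed.

Definition is_exppoly f := exists s, f =1 exppoly s.

Lemma is_exppolyD f g :
  is_exppoly f -> is_exppoly g -> is_exppoly (fun t => f t + g t).
Proof.
move=> [s fE] [s' gE]; exists (s ++ s') => t.
by rewrite /exppoly big_cat fE gE.
Qed.

Lemma is_exppolyM f g :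
  is_exppoly f -> is_exppoly g -> is_exppoly (fun t => f t * g t).
Proof.
move=> [s fE] [s' gE].
exists [seq (x.1 * y.1, x.2 + y.2) | x <- s, y <- s'] => t.
rewrite fE gE /exppoly big_allpairs_dep mulr_suml; apply: eq_bigr => x _.
rewrite mulr_sumr; apply: eq_bigr => y _ /=.
by rewrite hornerM mulrDl expRD mulrACA.
Qed.

Lemma is_exppoly_horner (p : {poly R}) : is_exppoly (horner p).
Proof.
by exists [:: (p, 0)] => t; rewrite /exppoly big_seq1 /= mul0r expR0 mulr1.
Qed.

Lemma is_exppoly_affine (A B : R) : is_exppoly (fun t => A + B * t).
Proof.
have [s sE] := is_exppoly_horner (A%:P + B *: 'X).
by exists s => t; rewrite -sE !hornerE.
Qed.

Lemma is_exppoly_expR (A B : R) : is_exppoly (fun t => expR (A + B * t)).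
Proof.
exists [:: ((expR A)%:P, B)] => t.
by rewrite /exppoly big_seq1 /= hornerC expRD.
Qed.

Lemma is_exppoly_cst (c : R) : is_exppoly (fun=> c).
Proof.
by have [s sE] := is_exppoly_horner c%:P; exists s => t; rewrite -sE hornerC.
Qed.

Lemma is_exppoly_sum (I : finType) (F : I -> R -> R) :
  (forall i, is_exppoly (F i)) -> is_exppoly (fun t => \sum_i F i t).
Proof.
move=> /choice[s sE]; exists (flatten [seq s i | i <- index_enum I]) => t.
rewrite /exppoly big_flatten big_map /=; apply: eq_bigr => i _; exact: sE.
Qed.

(** The vanishing principle applied to the difference, written as [f + (-1) * g]. *)
Lemma exppoly_identity f g (tau : R) : is_exppoly f -> is_exppoly g ->
  0 < tau -> (forall t, 0 < t < tau -> f t = g t) -> f =1 g.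
Proof.
move=> fP gP tau0 fg t.
have [s sE] := is_exppolyD fP (is_exppolyM (is_exppoly_cst (-1)) gP).
have := @exppoly_eq0 tau s tau0 _ t; rewrite -sE => h.
apply/eqP; rewrite -subr_eq0 -mulN1r h // => u /fg fgu.
by rewrite -sE fgu; ring.
Qed.

End ExponentialPolynomials.

(** * Sums of exponentials that satisfy affine or rational identities *)

Section SumsOfExponentials.
Variables (R : realType) (V : finType) (smax : R) (syl : V -> R).
Variables (al ga : V -> R).
Hypotheses (V_gt0 : (0 < #|V|)%N) (syl_bnd : forall w, 1 <= syl w <= smax).

(** [expsum] and [wexpsum] are the functions H and G of the overview. *)
Definition expsum (t : R) : R := \sum_w expR (al w + ga w * t).

Definition wexpsum (t : R) : R := \sum_w syl w * expR (al w + ga w * t).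

Lemma expR_le_expsum w t : expR (al w + ga w * t) <= expsum t.
Proof.
rewrite /expsum (bigD1 w) //= lerDl; apply: sumr_ge0 => *; exact: expR_ge0.
Qed.

Lemma expsum_gt0 t : 0 < expsum t.
Proof.
case/card_gt0P: V_gt0 => w _.
exact: lt_le_trans (expR_gt0 _) (expR_le_expsum w t).
Qed.

Lemma wexpsum_ge0 t : 0 <= wexpsum t.
Proof.
apply: sumr_ge0 => w _; apply: mulr_ge0 (expR_ge0 _).
by have := syl_bnd w; lra.
Qed.

Lemma wexpsum_le t : wexpsum t <= smax * expsum t.
Proof.
rewrite mulr_sumr; apply: ler_sum => w _.
by rewrite ler_wpM2r ?expR_ge0 //; case/andP: (syl_bnd w).
Qed.

Lemma is_exppoly_expsum : is_exppoly expsum.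
Proof. apply: is_exppoly_sum => w; exact: is_exppoly_expR. Qed.

Lemma is_exppoly_wexpsum : is_exppoly wexpsum.
Proof.
apply: is_exppoly_sum => w.
exact: is_exppolyM (is_exppoly_cst _) (is_exppoly_expR _ _).
Qed.

(** A nonzero slope would produce the value -1 at [- (A + 1) / B]. *)
Lemma affine_ge0_slope0 (A B : R) : (forall t, 0 <= A + B * t) -> B = 0.
Proof.
move=> h; apply/eqP; apply: contraT => B0.
by have := h (- (A + 1) / B); rewrite mulrC divfK //; lra.
Qed.

(** With a nonzero slope the exponent takes the value [M] somewhere, and there
    [expR M >= 1 + M > M]. *)
Lemma expR_affine_bounded_slope0 (A B M : R) :
  (forall t, expR (A + B * t) <= M) -> B = 0.
Proof.
move=> h; apply/eqP; apply: contraT => B0.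
have := h ((M - A) / B); have := expR_ge1Dx (A + B * ((M - A) / B)).
by rewrite (mulrC B) divfK //; lra.
Qed.

Lemma expR_gt_quadratic (A N x0 : R) : 0 <= N ->
  exists2 x, x0 <= x /\ 0 <= x & N * (1 + x) ^+ 2 < expR (A + x).
Proof.
(* The last summand ensures [24 * N <= expR A * x]. As [x >= 1], [N * (1 + x) ^+ 2 <= 4 * N * x ^+ 2
   <= expR A * (x ^+ 3 / 6)], and [x ^+ 3 / 6] is a Taylor term of [expR x]. *)
move=> N0; pose x := 1 + `|x0| + 24 * N * expR (- A).
have E0 : 0 < expR A := expR_gt0 A.
have EA : expR A * expR (- A) = 1 by rewrite expRN divff ?gt_eqF.
have nE0 : 0 <= N * expR (- A) by rewrite mulr_ge0 ?expR_ge0.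
have x1 : 1 <= x by rewrite /x; have := normr_ge0 x0; lra.
exists x; first by split; [rewrite /x; have := ler_norm x0; lra | lra].
have := @expR_ge1Dxn R x 2; rewrite (_ : 3`!%:R = 6 :> R) // => /(_ _)/wrap[].
  lra.
move=> h.
have xN : 24 * N <= expR A * x.
  rewrite /x; have -> : expR A * (1 + `|x0| + 24 * N * expR (- A)) =
    expR A * (1 + `|x0|) + 24 * N * (expR A * expR (- A)) by ring.
  rewrite EA mulr1 lerDr mulr_ge0 ?ltW //; have := normr_ge0 x0; lra.
rewrite expRD.
apply: (@le_lt_trans _ _ (4 * N * x ^+ 2)).
  rewrite [4 * N]mulrC -mulrA ler_wpM2l //; nra.
apply: (@le_lt_trans _ _ (expR A * (x ^+ 3 / 6))).
  have -> : expR A * (x ^+ 3 / 6) = (expR A * x / 6) * x ^+ 2 by field.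
  by rewrite ler_wpM2r ?sqr_ge0 //; lra.
by rewrite ltr_pM2l //; lra.
Qed.

(** Once the identity holds for all real [t], the affine factor is positive everywhere, hence
    constant. Then [expsum] is constant and bounds each of its exponentials. *)
Lemma eos_affine_degenerate (A B : R) :
  (forall t, 0 < t < 1 -> (A + B * t) * (1 + expsum t) = 1) ->
  forall w, ga w = 0.
Proof.
move=> h w.
have e t : (A + B * t) * (1 + expsum t) = 1.
  apply: (exppoly_identity _ _ ltr01 h); last exact: is_exppoly_cst.
  apply: is_exppolyM; first exact: is_exppoly_affine.
  exact: is_exppolyD (is_exppoly_cst _) is_exppoly_expsum.
have H0 := expsum_gt0.
have pos t : 0 < A + B * t.
  by rewrite -(pmulr_lgt0 _ (_ : 0 < 1 + expsum t)) ?e ?ltr01 // addr_gt0.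
have B0 : B = 0 by apply: (@affine_ge0_slope0 A) => t; rewrite ltW.
apply: (@expR_affine_bounded_slope0 (al w) _ A^-1) => t.
have := pos t; have := e t; rewrite B0 mul0r addr0 => eA A0.
apply: le_trans (expR_le_expsum w t) _.
rewrite -[X in _ <= X]mulr1 -eA mulKf ?gt_eqF //; lra.
Qed.

(** Same extension to the line, with [wexpsum >= 0] giving the sign. Only [D = 0] is concluded: the
    quotient [wexpsum / (1 + expsum)] can be constant while some [ga w] is nonzero. *)
Lemma syl_affine_constant (C D : R) :
  (forall t, 0 < t < 1 -> wexpsum t = (C + D * t) * (1 + expsum t)) -> D = 0.
Proof.
move=> h.
have e t : wexpsum t = (C + D * t) * (1 + expsum t).
  apply: (exppoly_identity _ _ ltr01 h); first exact: is_exppoly_wexpsum.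
  apply: is_exppolyM; first exact: is_exppoly_affine.
  exact: is_exppolyD (is_exppoly_cst _) is_exppoly_expsum.
apply: (@affine_ge0_slope0 C) => t.
rewrite -(pmulr_lge0 _ (_ : 0 < 1 + expsum t)) -?e ?wexpsum_ge0 //.
by rewrite addr_gt0 ?expsum_gt0.
Qed.

(* The left-hand side grows exponentially in one direction as soon as some
   [ga w] is nonzero, the right-hand side is a rational function of [t]. *)
Lemma outer_affine_degenerate (r tau A B C D : R) : 0 < r -> 0 < tau ->
  0 < A < 1 ->
  (forall t, 0 < t < tau -> 0 < A + B * t < 1) ->
  (forall t, 0 < t < tau ->
     expsum t + r * (wexpsum t / expsum t) =
     (1 - (A + B * t)) / (A + B * t) + r * ((C + D * t) / (1 - (A + B * t)))) ->
  forall w, ga w = 0.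
Proof.
move=> r0 tau0 A01 u01 h w; have H0 := expsum_gt0.
(* [u] and [v] stand for the affine rates e and sigma. Multiplying the hypothesis by
   [expsum t * p t], where [p = u (1 - u)], clears all denominators and turns its right-hand side
   into [expsum t * q t]. *)
pose u t := A + B * t; pose v t := C + D * t.
pose p t := u t * (1 - u t); pose q t := (1 - u t) ^+ 2 + r * v t * u t.
have e0 : (fun t => expsum t * expsum t * p t + r * wexpsum t * p t) =1
          (fun t => expsum t * q t).
  have iu : is_exppoly u by exact: is_exppoly_affine.
  have iv : is_exppoly v by exact: is_exppoly_affine.
  have iu1 : is_exppoly (fun t => 1 - u t).
    have [s sE] := is_exppoly_affine (1 - A) (- B).
    by exists s => t; rewrite -sE /u; ring.
  have ip := is_exppolyM iu iu1; have iH := is_exppoly_expsum.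
  have ic := is_exppoly_cst r.
  apply: (exppoly_identity _ _ tau0).
  - apply: is_exppolyD; first exact: is_exppolyM (is_exppolyM iH iH) ip.
    exact: is_exppolyM (is_exppolyM ic is_exppoly_wexpsum) ip.
  - apply: is_exppolyM iH _; apply: is_exppolyD.
      by have [s sE] := is_exppolyM iu1 iu1; exists s => t; rewrite -sE expr2.
    exact: is_exppolyM (is_exppolyM ic iv) iu.
  - move=> t t01; have := u01 t t01; have := h t t01; rewrite /p /q -/(u t) -/(v t).
    move=> ht /andP[ut0 ut1]; have Ht := H0 t.
    transitivity (expsum t * (u t * (1 - u t)) *
                  (expsum t + r * (wexpsum t / expsum t))).
      by field; rewrite gt_eqF.
    by rewrite ht; field; rewrite !gt_eqF //; lra.
have smax0 : 0 <= smax by case/card_gt0P: V_gt0 => w0 _; have := syl_bnd w0; lra.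
(* Divide by [expsum t] and use [wexpsum / expsum <= smax]. Keeping [p t] as a factor makes the
   bound valid at the zeros of [p] too. *)
have e1 t : `|p t| * expsum t <= `|q t| + r * smax * `|p t|.
  have Ht := H0 t.
  have eq : p t * expsum t = q t - r * (wexpsum t / expsum t) * p t.
    apply: (mulfI (lt0r_neq0 Ht)); rewrite mulrBr -(e0 t) /=.
    by field; rewrite gt_eqF.
  rewrite -[expsum t]gtr0_norm // -normrM eq (le_trans (ler_normB _ _)) //.
  rewrite lerD2l normrM ler_wpM2r // ger0_norm.
    by rewrite (ler_wpM2l (ltW r0)) // ler_pdivrMr // wexpsum_le.
  by rewrite (mulr_ge0 (ltW r0)) // divr_ge0 ?wexpsum_ge0 // ltW.
apply/eqP; apply: contraT => g0.
set g := ga w in g0.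
pose k := A * (1 - A).
have k0 : 0 < k by rewrite /k mulr_gt0 //; lra.
(* For [|B t| >= 2] both [|u t|] and [|1 - u t|] are at least 1, and [k <= 1]. If [B = 0], then
   [2 / 0 = 0] makes the premise void and [p] is the constant [k]. *)
have p_ge t : 2 / `|B| <= `|t| -> k <= `|p t|.
  have [B0|B0] := eqVneq B 0.
    by rewrite /p /u B0 mul0r addr0 -/k (gtr0_norm k0).
  rewrite ler_pdivrMr ?normr_gt0 // mulrC -normrM => Bt.
  have k1 : k <= 1 by rewrite /k; nra.
  apply: le_trans k1 _; rewrite /p normrM -[X in X <= _]mulr1; apply: ler_pM => //.
    have -> : u t = B * t - - A by rewrite /u; ring.
    have := lerB_normD (B * t) A; rewrite opprK (gtr0_norm (_ : 0 < A)); lra.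
  have -> : 1 - u t = (1 - A) - B * t by rewrite /u; ring.
  rewrite distrC; have := lerB_normD (B * t) (- (1 - A)).
  by rewrite normrN (gtr0_norm (_ : 0 < 1 - A)); lra.
pose L := 1 + `|B|; pose M := L ^+ 2 + r * (`|C| + `|D|) * L.
have M0 : 0 <= M.
  by rewrite /M /L addr_ge0 ?sqr_ge0 // !mulr_ge0 ?addr_ge0 // ltW.
have q_le t : `|q t| <= M * (1 + `|t|) ^+ 2.
  have nB := normr_ge0 B; have nt := normr_ge0 t.
  have nC := normr_ge0 C; have nD := normr_ge0 D.
  have u_le : `|u t| <= L * (1 + `|t|).
    rewrite /u (le_trans (ler_normD _ _)) // normrM (gtr0_norm (_ : 0 < A)); last lra.
    by rewrite /L; nra.
  have u1_le : `|1 - u t| <= L * (1 + `|t|).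
    rewrite (_ : 1 - u t = (1 - A) - B * t); last by rewrite /u; ring.
    rewrite (le_trans (ler_normB _ _)) // normrM (gtr0_norm (_ : 0 < 1 - A)); last lra.
    by rewrite /L; nra.
  have v_le : `|v t| <= (`|C| + `|D|) * (1 + `|t|).
    by rewrite (le_trans (ler_normD _ _)) // normrM; nra.
  rewrite (le_trans (ler_normD _ _)) // normrX !normrM (gtr0_norm r0) /M.
  rewrite mulrDl -exprMn; apply: lerD.
    by rewrite lerXn2r ?nnegrE ?normr_ge0 // mulr_ge0 //; rewrite /L; lra.
  rewrite -!mulrA (ler_wpM2l (ltW r0)) //.
  rewrite (_ : (_ + _) * _ = ((`|C| + `|D|) * (1 + `|t|)) * (L * (1 + `|t|))); last ring.
  by rewrite ler_pM.
have H_le t : 2 / `|B| <= `|t| -> expsum t <= (M / k + r * smax) * (1 + `|t|) ^+ 2.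
  move=> /p_ge kp; have p0 : 0 < `|p t| by exact: lt_le_trans kp.
  rewrite -(ler_pM2l p0) (le_trans (e1 t)) // mulrDl mulrDr; apply: lerD.
    apply: le_trans (q_le t) _.
    rewrite [leRHS]mulrA ler_wpM2r ?sqr_ge0 // mulrA ler_pdivlMr //.
    by rewrite [M * k]mulrC ler_wpM2r.
  rewrite mulrC ler_wpM2l // -[X in X <= _]mulr1 ler_wpM2l //.
    by rewrite (mulr_ge0 (ltW r0)).
  by rewrite expr_ge1 //; have := normr_ge0 t; lra.
have N0 : 0 <= M / k + r * smax.
  by rewrite addr_ge0 // ?divr_ge0 // ?(mulr_ge0 (ltW r0)) // ltW.
(* The growth is tested at [t = x / g], whose sign follows that of [g]. There
   [1 + |t| <= (1 + |g^-1|) * (1 + x)], and [x >= 2 / |B| * |g|] gives [|t| >= 2 / |B|]. *)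
pose N := (M / k + r * smax) * (1 + `|g^-1|) ^+ 2.
have [x [xT x0]] := @expR_gt_quadratic (al w) N (2 / `|B| * `|g|)
  (mulr_ge0 N0 (sqr_ge0 _)).
have gx : g * (x / g) = x by rewrite mulrC divfK.
have nx : `|x / g| = x * `|g^-1| by rewrite normrM (ger0_norm x0).
rewrite -[X in expR (_ + X)]gx ltNge => /negP[].
apply: le_trans (expR_le_expsum w (x / g)) _.
apply: le_trans (H_le _ _) _.
  by rewrite nx normfV ler_pdivlMr ?normr_gt0.
rewrite -mulrA ler_wpM2l // -exprMn nx.
have ng := normr_ge0 g^-1.
by rewrite lerXn2r ?nnegrE ?mulr_ge0 ?addr_ge0 ?mulr_ge0 //; nra.
Qed.

End SumsOfExponentials.

(** * A strong law of large numbers for pairwise independent events *)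

Section StrongLaw.
Context (R : realType) (d : measure_display) (Omega : measurableType d).
Variable P : probability Omega R.
Implicit Types (f g : Omega -> R).

(** Integrability travels with the value, so linear combinations of means raise no side
    conditions. *)
Definition has_mean f (m : R) : Prop :=
  P.-integrable setT (EFin \o f) /\ (\int[P]_x (f x)%:E = m%:E)%E.

Lemma has_meanD f g m m' :
  has_mean f m -> has_mean g m' -> has_mean (fun x => f x + g x) (m + m').
Proof.
move=> [fi fm] [gi gm]; split; first exact: (integrableD measurableT fi gi).
under eq_integral do rewrite EFinD.
by rewrite integralD // fm gm.
Qed.

Lemma has_meanZ (c : R) f m :
  has_mean f m -> has_mean (fun x => c * f x) (c * m).
Proof.
move=> [fi fm]; split; first exact: (integrableZl measurableT c fi).
under eq_integral do rewrite EFinM.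
by rewrite integralZl // fm.
Qed.

Lemma has_mean_indic (A : set Omega) (m : R) :
  measurable A -> P A = m%:E -> has_mean \1_A m.
Proof.
move=> mA PA; split; first exact: integrable_indic.
by rewrite integral_indic // setIT.
Qed.

Lemma has_mean_cst (c : R) : has_mean (fun=> c) c.
Proof.
have [i m] := has_meanZ c (has_mean_indic measurableT (probability_setT P)).
rewrite (_ : (fun=> c) = (fun x => c * \1_setT x)).
  by split => //; rewrite m mulr1.
by apply/funext => x; rewrite indicE in_setT mulr1.
Qed.

Lemma has_mean_sum (I : Type) (s : seq I) (f : I -> Omega -> R) (m : I -> R) :
  (forall i, has_mean (f i) (m i)) ->
  has_mean (fun x => \sum_(i <- s) f i x) (\sum_(i <- s) m i).
Proof.
move=> fm; elim: s => [|i s IH].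
  rewrite big_nil (_ : (fun x => _) = fun=> 0); first exact: has_mean_cst.
  by apply/funext => x; rewrite big_nil.
rewrite big_cons (_ : (fun x => _) = fun x => f i x + \sum_(j <- s) f j x).
  exact: has_meanD.
by apply/funext => x; rewrite big_cons.
Qed.

Lemma inverse_squares_bounded (n : nat) :
  \sum_(0 <= m < n) (m.+1%:R ^+ 2)^-1 <= 2 :> R.
Proof.
(* The sharper bound [2 - 2 / n.+1] makes the induction go through. *)
apply: (@le_trans _ _ (2 - 2 / n.+1%:R)); last by rewrite gerBl divr_ge0.
elim: n => [|n IH]; first by rewrite big_nil divr1 subrr.
rewrite big_nat_recr //=; apply: le_trans (lerD IH (lexx _)) _.
rewrite -subr_ge0 -[n.+2%:R]natr1.
have n1 : 1 <= n.+1%:R :> R by rewrite ler1n.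
move: n.+1%:R n1 => x x1.
rewrite (_ : _ - _ = (x - 1) / (x ^+ 2 * (x + 1))); last first.
  by field; rewrite !gt_eqF //; lra.
by rewrite divr_ge0 ?mulr_ge0 ?sqr_ge0 //; lra.
Qed.

(* Between consecutive squares [u] varies by at most [2 m + 3]. *)
Lemma cvg_of_squares (u : nat -> R) : (forall n, `|u n.+1 - u n| <= 1) ->
  (fun m => (u (m.+1 ^ 2)%N / (m.+1 ^ 2)%:R) ^+ 2) @ \oo --> (0 : R) ->
  (fun n => u n / n%:R) @ \oo --> (0 : R).
Proof.
move=> u1 usq.
have udist m n : `|u (m + n)%N - u m| <= n%:R.
  elim: n => [|n IH]; first by rewrite addn0 subrr normr0.
  rewrite addnS -natr1 [leRHS]addrC.
  have -> : u (m + n).+1 - u m = (u (m + n).+1 - u (m + n)%N) + (u (m + n)%N - u m).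
    by ring.
  by rewrite (le_trans (ler_normD _ _)) // lerD.
have sqrt_nat n : (0 < n)%N -> exists m, (m.+1 ^ 2 <= n < m.+2 ^ 2)%N.
  elim: n => // -[_ _|n /(_ isT)[m /andP[m1 m2]] _]; first by exists 0%N.
  have [h|h] := ltnP n.+2 (m.+2 ^ 2)%N.
    by exists m; rewrite h andbT ltnW.
  by exists m.+1; rewrite h /= (leq_ltn_trans m2) // ltn_exp2r.
apply/cvgr0Pnorm_lt => eps eps0.
have e2 : 0 < (eps / 2) ^+ 2 by rewrite exprn_gt0 // divr_gt0.
have [M _ hM] := (cvgr0Pnorm_lt _).1 usq _ e2.
(* If [m.+1 > 6 / eps], the variation [2 * m.+1] since the last square is below
   [eps / 2 * m.+1 ^+ 2]; the other half of [eps] pays for the value at that square. *)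
pose K := Num.bound (6 / eps).
have K_gt : 6 / eps < K%:R by rewrite archi_boundP // divr_ge0 // ltW.
exists ((maxn M K).+1 ^ 2)%N => //= n /= nM.
have n0 : (0 < n)%N by apply: leq_trans nM; rewrite expn_gt0.
have [m /andP[m1 m2]] := sqrt_nat n n0.
have mMK : (maxn M K <= m)%N.
  by have := leq_ltn_trans nM m2; rewrite ltn_exp2r // ltnS.
have hm := hM m (leq_trans (leq_maxl _ _) mMK).
have mK : 6 / eps < m.+1%:R.
  rewrite (lt_le_trans K_gt) // ler_nat (leq_trans (leq_maxr M K)) //.
  exact: leq_trans mMK _.
set k := (m.+1 ^ 2)%N in hm m1.
have k0 : 0 < k%:R :> R by rewrite ltr0n expn_gt0.
have uk : `|u k| < eps / 2 * k%:R.
  move: hm; rewrite /= normrX ltr_pXn2r ?nnegrE // ?divr_ge0 ?(ltW eps0) //.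
  by rewrite normrM normfV (gtr0_norm k0) ltr_pdivrMr.
have nR : 0 < n%:R :> R by rewrite ltr0n.
have kn : k%:R <= n%:R :> R by rewrite ler_nat.
have unk : `|u n| <= `|u k| + 2 * m.+1%:R.
  have := udist k (n - k)%N; rewrite subnKC // => h.
  have -> : u n = u k + (u n - u k) by ring.
  rewrite (le_trans (ler_normD _ _)) // lerD2l (le_trans h) //.
  rewrite -natrM ler_nat leq_subLR; move: m2; rewrite /k; lia.
have kE : k%:R = m.+1%:R ^+ 2 :> R by rewrite natrX.
rewrite normrM normfV (gtr0_norm nR) ltr_pdivrMr //.
have m0 : 0 < m.+1%:R :> R by [].
move: mK; rewrite ltr_pdivrMr // => mK.
nra.
Qed.

Lemma has_mean_cov (A B : set Omega) (p q pq : R) :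
  measurable A -> measurable B ->
  P A = p%:E -> P B = q%:E -> P (A `&` B) = pq%:E ->
  has_mean (fun x => (\1_A x - p) * (\1_B x - q)) (pq - p * q).
Proof.
move=> mA mB PA PB PAB.
have hA := has_mean_indic mA PA; have hB := has_mean_indic mB PB.
have hAB := has_mean_indic (measurableI _ _ mA mB) PAB.
have := has_meanD (has_meanD hAB (has_meanZ (- q) hA))
  (has_meanD (has_meanZ (- p) hB) (has_mean_cst (p * q))).
rewrite (_ : pq + _ + _ = pq - p * q); last by ring.
congr has_mean; apply/funext => x; rewrite !indicE in_setI.
by case: (x \in A); case: (x \in B) => /=; ring.
Qed.

(** Expand the square: the off-diagonal covariances vanish, and each of the [n] diagonal terms is
    the variance [p - p * p]. *)
Lemma has_mean_sqr_sum (A : nat -> set Omega) (p : R) (n : nat) :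
  (forall i, measurable (A i)) -> (forall i, P (A i) = p%:E) ->
  (forall i j, i != j -> P (A i `&` A j) = (p * p)%:E) ->
  has_mean (fun x => (\sum_(0 <= i < n) (\1_(A i) x - p)) ^+ 2)
    (n%:R * (p - p * p)).
Proof.
move=> mA PA PAA.
have cov i j := @has_mean_cov (A i) (A j) p p (if i == j then p else p * p)
   (mA i) (mA j) (PA i) (PA j).
have := has_mean_sum (index_iota 0 n) (fun i => has_mean_sum (index_iota 0 n)
  (fun j => cov i j _)).
move=> /(_ _)/wrap[] => [i j|].
  by case: eqVneq => [<-|/PAA //]; rewrite setIid; exact: PA.
congr has_mean.
  apply/funext => x; rewrite expr2 mulr_suml.
  by apply: eq_bigr => i _; rewrite mulr_sumr.
rewrite -[in RHS](subn0 n) mulr_natl -sumr_const_nat.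
apply: eq_big_nat => i /andP[_ i_lt].
rewrite (bigD1_seq i) ?mem_index_iota ?iota_uniq //= eqxx big1 ?addr0 // => j.
by rewrite eq_sym => /negPf ->; rewrite subrr.
Qed.

Lemma pairwise_slln (A : nat -> set Omega) (p : R) :
  (forall i, measurable (A i)) -> (forall i, P (A i) = p%:E) ->
  (forall i j, i != j -> P (A i `&` A j) = (p * p)%:E) ->
  {ae P, forall x,
    (fun n => (\sum_(0 <= i < n) \1_(A i) x) / n%:R) @ \oo --> p}.
Proof.
move=> mA PA PAA.
pose D n x : R := \sum_(0 <= i < n) (\1_(A i) x - p).
pose f m x : R := (D (m.+1 ^ 2)%N x / (m.+1 ^ 2)%:R) ^+ 2.
have f0 m x : 0 <= f m x by exact: sqr_ge0.
have fM m : has_mean (f m) ((m.+1%:R ^+ 2)^-1 * (p - p * p)).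
  have := has_meanZ (((m.+1 ^ 2)%:R^-1) ^+ 2)
    (has_mean_sqr_sum (m.+1 ^ 2) mA PA PAA).
  congr has_mean; first by apply/funext => x; rewrite /f -exprMn mulrC.
  rewrite natrX; move: m.+1%:R (ltr0Sn R m) => y y0.
  by field; rewrite gt_eqF.
have /andP[p_ge0 p_le1] : 0 <= p <= 1.
  by rewrite -!lee_fin -(PA 0%N) measure_ge0 probability_le1.
have p1 : p - p * p <= 1 by have := sqr_ge0 (p - 1 / 2); lra.
have mf m := measurable_int _ (fM m).1.
(* Sum and integral are exchanged by nonnegativity; the means are dominated by the inverse
   squares. *)
have intf : (\int[P]_x (\sum_(0 <= m <oo) (f m x)%:E) <= 2%:E)%E.
  rewrite integral_nneseries //; last by move=> m x _; rewrite lee_fin.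
  apply: lime_le.
    apply: is_cvg_nneseries => m _ _.
    by apply: integral_ge0 => x _; rewrite lee_fin.
  apply: nearW => n.
  under eq_bigr do rewrite (fM _).2.
  rewrite sumEFin lee_fin; apply: le_trans (inverse_squares_bounded n).
  by apply: ler_sum => m _; rewrite ler_piMr ?invr_ge0 ?sqr_ge0.
(* A nonnegative function of finite integral is finite almost everywhere; at such points the terms
   [f m x] tend to 0. *)
have fin : {ae P, forall x, setT x -> (\sum_(0 <= m <oo) (f m x)%:E)%E \is a fin_num}.
  apply: integrable_ae => //; apply/integrableP; split.
    apply: (@ge0_emeasurable_sum _ _ _ setT (fun m x => (f m x)%:E) xpredT) => //.
      by move=> m x _ _; rewrite lee_fin.
    by move=> m _; exact: mf.
  apply: le_lt_trans (ltry 2); apply: le_trans intf.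
  rewrite le_eqVlt; apply/orP; left; apply/eqP.
  apply: eq_integral => x _; rewrite gee0_abs //.
  by apply: nneseries_ge0 => *; rewrite lee_fin.
move: fin; apply: filterS => x /(_ I) fx.
have /cvg_series_cvg_0 sq0 : cvgn (series (f ^~ x)).
  by apply: nnseries_is_cvg => //; rewrite ltey_eq fx.
have DE n : D n x = \sum_(0 <= i < n) \1_(A i) x - n%:R * p.
  by rewrite /D sumrB sumr_const_nat subn0 mulr_natl.
have /cvg_of_squares : forall n, `|D n.+1 x - D n x| <= 1.
  move=> n; rewrite /D big_nat_recr //= addrAC subrr add0r indicE ler_norml.
  by case: (x \in A n) => /=; lra.
move=> /(_ sq0) D0.
have : (fun n => D n x / n%:R + p) @ \oo --> 0 + p by apply: cvgD D0 (cvg_cst _).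
(* The two sequences are compared from [n = 1] on, since at [n = 0] the quotients are 0 by
   convention. *)
rewrite add0r; apply: cvg_trans; apply: near_eq_cvg; exists 1%N => // n /= n0.
by rewrite DE mulrBl mulrAC divff ?mul1r ?subrK // pnatr_eq0 -lt0n.
Qed.

End StrongLaw.

(** * From token frequencies to the limit of the score *)

Section LongTextLimit.
Context (R : realType) (V : finType).

(** The strong law is applied to each value [x] separately; finiteness of [T] allows one null set
    for all of them. *)
Lemma iid_frequencies_cvg (T : finType) (d : measure_display)
    (Omega : measurableType d) (P : probability Omega R)
    (X : nat -> Omega -> T) (p : T -> R) : iid P X p ->
  {ae P, forall omega, forall x,
    (fun N => (\sum_(i < N) (X i omega == x)%:R) / N%:R) @ \oo --> p x}.
Proof.
move=> [mX PX indep]; apply: filter_forall => x.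
pose A i := X i @^-1` [set x].
have mA i : measurable (A i) by exact: mX.
have PA i : P (A i) = (p x)%:E by exact: PX.
have PAA i j : i != j -> P (A i `&` A j) = (p x * p x)%:E.
  move=> ij; have := indep [fset i; j]%fset (fun=> [set x]).
  rewrite big_fsetU1 /= ?inE // big_seq_fset1 -!/(A _) !PA -EFinM => <-.
  congr (P _); apply/seteqP; split => [w [wi wj] k /=|w h].
    by rewrite !inE => /orP[] /eqP ->.
  by split; apply: h; rewrite /= !inE eqxx ?orbT.
have := pairwise_slln mA PA PAA; apply: filterS => w.
rewrite (_ : (fun N => _) = (fun N => (\sum_(i < N) (X i w == x)%:R) / N%:R)) //.
apply/funext => N; rewrite big_mkord; congr (_ / _); apply: eq_bigr => i _.
rewrite indicE; congr (_%:R); congr nat_of_bool; apply/idP/eqP; rewrite inE //.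
Qed.

Lemma sum_token (F : token V -> R) : \sum_v F v = F None + \sum_w F (Some w).
Proof.
rewrite (bigD1 None) //=; congr (_ + _).
rewrite (reindex_omap Some id) => [|[w|]] //=.
by apply: eq_bigl => w; rewrite eqxx.
Qed.

(** Purely deterministic: after division by [N] the score is [outer_form] at the empirical rates,
    and [outer_form] is continuous where [0 < e < 1]. *)
Lemma fkgl_limit (syl : V -> R) (a b c dflt : R) (p : token V -> R)
    (v : nat -> token V) : 0 < p None < 1 ->
  (forall x, (fun N => (\sum_(i < N) (v i == x)%:R) / N%:R) @ \oo --> p x) ->
  fkgl syl a b c dflt v @ \oo --> outer_form a b c (p None) (syl_rate syl p).
Proof.
move=> /andP[e0 e1] freq.
pose e N : R := (\sum_(i < N) (v i == None)%:R) / N%:R.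
pose s N : R := (\sum_(i < N) syl_ext syl (v i)) / N%:R.
have e_cvg : e @ \oo --> p None by exact: freq.
have s_cvg : s @ \oo --> syl_rate syl p.
  have -> : syl_rate syl p = \sum_x syl_ext syl x * p x.
    by rewrite sum_token mul0r add0r; apply: eq_bigr => w _; rewrite mulrC.
  have -> : s = fun N => \sum_x syl_ext syl x * ((\sum_(i < N) (v i == x)%:R) / N%:R).
    apply/funext => N; rewrite /s mulr_suml.
    under [RHS]eq_bigr do rewrite mulrA mulr_sumr mulr_suml.
    rewrite exchange_big; apply: eq_bigr => i _ /=.
    rewrite (bigD1 (v i)) //= eqxx mulr1 big1 ?addr0 // => x.
    by rewrite eq_sym => /negPf ->; rewrite mulr0 mul0r.
  apply: cvg_big => [|x _]; first exact: add_continuous.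
  by apply: cvgM (freq x); exact: cvg_cst.
(* These two facts exclude the default value [dflt] for large [N]. *)
have e_pos : \forall N \near \oo, 0 < e N by exact: (cvgr_gt (p None)).
have e_lt1 : \forall N \near \oo, e N < 1 by exact: (cvgr_lt (p None)).
have lim : (fun N => outer_form a b c (e N) (s N)) @ \oo -->
    outer_form a b c (p None) (syl_rate syl p).
  have f_cvg : (fun N => 1 - e N) @ \oo --> 1 - p None.
    by apply: cvgB => //; exact: cvg_cst.
  rewrite /outer_form; apply: cvgD; last exact: cvg_cst.
  apply: cvgD; (apply: cvgM; first exact: cvg_cst);
    apply: cvgM => //; apply: cvgV => //.
    by rewrite gt_eqF.
  by rewrite subr_eq0 gt_eqF.
apply: cvg_trans lim; apply: near_eq_cvg; near=> N.
have N0 : 0 < N%:R :> R by rewrite ltr0n; near: N; exists 1%N.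
have eN0 : 0 < e N by near: N.
have eN1 : 0 < 1 - e N by rewrite subr_gt0; near: N.
rewrite /fkgl /outer_form.
have SE : \sum_(n < N) (v n == None)%:R = e N * N%:R.
  by rewrite /e divfK // gt_eqF.
have YE : \sum_(n < N) syl_ext syl (v n) = s N * N%:R.
  by rewrite /s divfK // gt_eqF.
rewrite /= SE YE; move: (e N) (s N) N%:R N0 eN0 eN1 => x y z z0 x0 x1.
have -> : z - x * z = (1 - x) * z by ring.
rewrite !mulf_eq0 !gt_eqF //=.
by field; rewrite !gt_eqF.
Unshelve. all: by end_near.
Qed.

Lemma long_text_limit_outer_form (syl : V -> R) (a b c dflt : R)
    (p : token V -> R) :
  0 < p None < 1 ->
  long_text_limit syl a b c dflt p
    (outer_form a b c (eos_rate p) (syl_rate syl p)).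
Proof.
move=> p01 d Omega P v /iid_frequencies_cvg; apply: filterS => omega.
exact: fkgl_limit.
Qed.

End LongTextLimit.

(** * The softmax model along segments of the simplex *)

Section SoftmaxModel.
Context (R : realType) (V : finType) (K : nat).
Variables (beta : 'M[R]_(K, #|{: token V}|)) (bias : 'cV[R]_(#|{: token V}|)).
Implicit Types theta : 'cV[R]_K.

Let l := logit beta bias.
Let model := softmax_model beta bias.

Lemma softmax_modelE theta v :
  model theta v = expR (l theta v) / \sum_u expR (l theta u).
Proof.
rewrite /model /softmax_model /softmax mxE; congr (expR _ / _); first by rewrite mxE.
rewrite (reindex enum_rank) /=; last exact/onW_bij/enum_rank_bij.
by apply: eq_bigr => u _; rewrite mxE.
Qed.

(** Taking the boundary token as reference removes the normalising sum and leaves a quantity affine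
    in [theta]. *)
Definition log_odds theta w : R := l theta (Some w) - l theta None.

Definition word_odds theta w : R := expR (log_odds theta w).

Lemma softmax_model_eos theta :
  model theta None = (1 + \sum_w word_odds theta w)^-1.
Proof.
rewrite softmax_modelE sum_token -[in LHS](mulr1 (expR _)).
under [X in _ / (_ + X)]eq_bigr => w _.
  rewrite -[l theta (Some w)](subrK (l theta None)) addrC expRD; over.
by rewrite -mulr_sumr -mulrDr -mulf_div divff ?gt_eqF ?expR_gt0 // mul1r div1r.
Qed.

Lemma softmax_model_word theta w :
  model theta (Some w) = word_odds theta w * model theta None.
Proof.
rewrite !softmax_modelE /word_odds /log_odds mulrA; congr (_ / _).
by rewrite -expRD subrK.
Qed.

Lemma softmax_model_eos_bounds theta : (0 < #|V|)%N -> 0 < model theta None < 1.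
Proof.
case/card_gt0P => w _; rewrite softmax_model_eos.
have S0 : 0 < \sum_u word_odds theta u.
  rewrite (bigD1 w) //= ltr_pwDl ?expR_gt0 //.
  by apply: sumr_ge0 => u _; exact: expR_ge0.
by rewrite invr_gt0 invf_lt1; lra.
Qed.

Lemma syl_rate_softmax (syl : V -> R) theta :
  syl_rate syl (model theta) =
  (\sum_w syl w * word_odds theta w) * model theta None.
Proof.
rewrite /syl_rate mulr_suml; apply: eq_bigr => w _.
by rewrite softmax_model_word; ring.
Qed.

Lemma softmax_model_inj theta theta' :
  log_odds theta =1 log_odds theta' -> model theta = model theta'.
Proof.
move=> h; have oddsE : word_odds theta =1 word_odds theta'.
  by move=> w; rewrite /word_odds h.
have eosE : model theta None = model theta' None.
  by rewrite !softmax_model_eos (eq_bigr _ (fun w _ => oddsE w)).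
by apply/funext => -[w|] //; rewrite !softmax_model_word oddsE eosE.
Qed.

Definition segment theta theta' (t : R) : 'cV[R]_K := theta + t *: (theta' - theta).

Lemma segment_simplex theta theta' t : simplex R K theta -> simplex R K theta' ->
  0 < t < 1 -> simplex R K (segment theta theta' t).
Proof.
move=> [h1 s1] [h2 s2] t01.
have E k : segment theta theta' t k 0 = (1 - t) * theta k 0 + t * theta' k 0.
  by rewrite !mxE; ring.
split=> [k|]; first by rewrite E addr_ge0 // mulr_ge0 //; lra.
by rewrite (eq_bigr _ (fun k _ => E k)) big_split /= -!mulr_sumr s1 s2; ring.
Qed.

Lemma dotv_segment q theta theta' t :
  dotv q (segment theta theta' t) =
  dotv q theta + (dotv q theta' - dotv q theta) * t.
Proof.
rewrite /dotv /segment mulmxDr -scalemxAr mulmxBr !mxE; ring.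
Qed.

Lemma logit_segment theta theta' t v :
  l (segment theta theta' t) v = l theta v + (l theta' v - l theta v) * t.
Proof.
rewrite /l /logit /segment mulmxDr -scalemxAr mulmxBr !mxE; ring.
Qed.

Section Segment.
Variables (syl : V -> R) (theta theta' : 'cV[R]_K).

Let al := log_odds theta.
Let ga w := log_odds theta' w - log_odds theta w.

Lemma word_odds_segment t w :
  word_odds (segment theta theta' t) w = expR (al w + ga w * t).
Proof. by congr expR; rewrite /log_odds !logit_segment /ga /al /log_odds; ring. Qed.

Lemma eos_segment t :
  model (segment theta theta' t) None = (1 + expsum al ga t)^-1.
Proof.
rewrite softmax_model_eos; congr (_ + _)^-1.
by apply: eq_bigr => w _; exact: word_odds_segment.
Qed.

Lemma syl_rate_segment t :
  syl_rate syl (model (segment theta theta' t)) =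
  wexpsum syl al ga t / (1 + expsum al ga t).
Proof.
rewrite syl_rate_softmax eos_segment; congr (_ / _).
by apply: eq_bigr => w _; rewrite word_odds_segment.
Qed.

(** Turns the conclusion of the degeneracy lemmas, that all slopes vanish, into equality of the
    model at the two endpoints. *)
Lemma segment_slopes0 : (forall w, ga w = 0) -> model theta = model theta'.
Proof.
move=> h; apply: softmax_model_inj => w; apply/esym/eqP.
by rewrite -subr_eq0; apply/eqP; exact: h.
Qed.

End Segment.

Variables (smax : R) (syl : V -> R).
Hypotheses (V_gt0 : (0 < #|V|)%N) (syl_bnd : forall w, 1 <= syl w <= smax).

Lemma softmax_eos_nonlinear : nonconstant_on_simplex model ->
  ~ linear_on_simplex (fun theta => eos_rate (model theta)).
Proof.
move=> [theta [theta' [h h' ne]]] [q qE]; apply: ne; apply: segment_slopes0.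
apply: (@eos_affine_degenerate _ _ (log_odds theta) _ V_gt0
  (dotv q theta) (dotv q theta' - dotv q theta)) => t t01.
rewrite -dotv_segment -qE /=; last exact: segment_simplex.
rewrite /eos_rate eos_segment mulVf // gt_eqF //.
by rewrite addr_gt0 // expsum_gt0.
Qed.

Lemma softmax_syl_nonlinear :
  nonconstant_on_simplex (fun theta => syl_rate syl (model theta)) ->
  ~ linear_on_simplex (fun theta => syl_rate syl (model theta)).
Proof.
move=> [theta [theta' [h h' ne]]] [s sE]; apply: ne.
rewrite !sE //; apply/eqP; rewrite eq_sym -subr_eq0; apply/eqP.
apply: (@syl_affine_constant _ _ smax syl
  (log_odds theta) (fun w => log_odds theta' w - log_odds theta w) V_gt0 syl_bnd
  (dotv s theta)) => t t01.
rewrite -dotv_segment -sE /=; last exact: segment_simplex.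
by rewrite syl_rate_segment divfK // gt_eqF // addr_gt0 // expsum_gt0.
Qed.

Lemma softmax_admixture_formula_fails (a b c : R) : 0 < b / a ->
  nonconstant_on_simplex model ->
  ~ admixture_formula_applies a b c (fun theta =>
      outer_form a b c (eos_rate (model theta)) (syl_rate syl (model theta))).
Proof.
move=> ba0 [th1 [th2 [h1 h2 ne]]] [q [s [[theta [h q01]] formula]]].
(* The segment must start at [theta], where the formula is defined; at least one of [th1], [th2] has
   a model different from that at [theta]. *)
have [theta' h' ne'] :
    exists2 theta', simplex R K theta' & model theta <> model theta'.
  have [e|] := pselect (model theta = model th1); last by exists th1.
  by exists th2 => //; rewrite e.
apply: ne'; apply: segment_slopes0.
set A := dotv q theta in q01.
pose B := dotv q theta' - dotv q theta.
(* For [t < tau], [|B t| < A * (1 - A)], which is below both [A] and [1 - A]; moreover [tau < 1]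
   keeps the points inside the segment. *)
pose tau := A * (1 - A) / (1 + `|B|).
have nB : 0 <= `|B| := normr_ge0 B.
have tau0 : 0 < tau by rewrite divr_gt0 ?mulr_gt0 //; lra.
have tau_lt1 : tau < 1 by rewrite ltr_pdivrMr; [nra | lra].
have u01 t : 0 < t < tau -> 0 < A + B * t < 1.
  move=> /andP[t0]; rewrite /tau ltr_pdivlMr; last lra.
  move=> ht; have := ler_norm (B * t); have := ler_norm (- (B * t)).
  rewrite normrN normrM (gtr0_norm t0); nra.
apply: (@outer_affine_degenerate _ _ smax syl (log_odds theta) _ V_gt0 syl_bnd (b / a) tau A B
  (dotv s theta) (dotv s theta' - dotv s theta)) => // t t01.
have u := u01 t t01.
have := formula (segment theta theta' t) _ _.
rewrite !dotv_segment => /(_ _ u)/wrap[].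
  by apply: segment_simplex => //; lra.
rewrite /eos_rate eos_segment syl_rate_segment /outer_form.
have := @expsum_gt0 R V (log_odds theta)
  (fun w => log_odds theta' w - log_odds theta w) V_gt0 t.
move: (expsum _ _ _) (wexpsum _ _ _ _) => H G H0.
move: u; rewrite -/A -/B.
move: (dotv s theta + _ * t) (A + B * t) => y x /andP[x0 x1].
(* Division by zero yields 0, so [0 < b / a] already forces [a] to be nonzero. *)
have a0 : a != 0 by apply: contraTneq ba0 => ->; rewrite invr0 mulr0 ltxx.
have {}x1 : 0 < 1 - x by rewrite subr_gt0.
(* Cancel [c] and divide by [a]: on the model side [(1 - e) / e] is [H] and [sigma / (1 - e)] is
   [G / H]. *)
move=> /addIr eqn; apply: (mulfI a0); apply: etrans (etrans eqn _).
  by field; rewrite a0 !gt_eqF //; lra.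
by field; rewrite a0 !gt_eqF.
Qed.

End SoftmaxModel.

(** * Admixture rates, a nondegenerate softmax example, and the final assembly *)

Lemma eos_rate_admixture (R : realType) (V : finType) (K : nat)
    (B : 'I_K -> token V -> R) (theta : 'cV[R]_K) :
  eos_rate (admixture_model B theta) = dotv (admixture_q B) theta.
Proof.
by rewrite /dotv mxE; apply: eq_bigr => k _; rewrite !mxE mulrC.
Qed.

Lemma syl_rate_admixture (R : realType) (V : finType) (syl : V -> R) (K : nat)
    (B : 'I_K -> token V -> R) (theta : 'cV[R]_K) :
  syl_rate syl (admixture_model B theta) = dotv (admixture_s syl B) theta.
Proof.
rewrite /dotv mxE /syl_rate /admixture_model.
under eq_bigr do rewrite mulr_suml.
rewrite exchange_big; apply: eq_bigr => k _; rewrite !mxE mulr_suml.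
by apply: eq_bigr => w _; ring.
Qed.

Lemma syl_rate_nonconstant_exists (R : realType) (V : finType) (smax : R)
    (syl : V -> R) (K : nat) :
  (0 < #|V|)%N -> (forall w, 1 <= syl w <= smax) -> (1 < K)%N ->
  exists (beta : 'M[R]_(K, #|{: token V}|)) (bias : 'cV[R]_(#|{: token V}|)),
    nonconstant_on_simplex
      (fun theta => syl_rate syl (softmax_model beta bias theta)).
Proof.
move=> V_gt0 syl_bnd K1; pose k0 := Ordinal (ltnW K1); pose k1 := Ordinal K1.
(* Only topic [k0] acts, raising the logit of the boundary token by 1. At a vertex of the simplex
   all words then share the same odds: [expR (-1)] at [k0], 1 elsewhere. *)
pose beta : 'M[R]_(K, #|{: token V}|) := delta_mx k0 (enum_rank None).
exists beta, 0.
have simplex_delta k : simplex R K (delta_mx k 0).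
  split=> [i|]; first by rewrite mxE.
  by rewrite (bigD1 k) //= mxE !eqxx big1 ?addr0 // => i /negPf ik; rewrite mxE ik.
exists (delta_mx k0 0), (delta_mx k1 0); split => //.
have odds k w : word_odds beta 0 (delta_mx k 0) w = expR (- (k == k0)%:R).
  rewrite /word_odds /log_odds /logit /beta trmx_delta mul_delta_mx_cond.
  rewrite [k0 == k]eq_sym; congr expR.
  rewrite !mxE ?eqxx; case: eqP => _; rewrite ?mulr1n ?mulr0n !mxE ?eqxx.
    by rewrite (inj_eq enum_rank_inj) /=; ring.
  by rewrite /=; ring.
have sigmaE k : let y := expR (- (k == k0)%:R) : R in
    syl_rate syl (softmax_model beta 0 (delta_mx k 0)) =
    (\sum_w syl w) * (y / (1 + y * #|V|%:R)).
  rewrite /= syl_rate_softmax softmax_model_eos [RHS]mulrA; congr (_ / (_ + _)).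
    by rewrite mulr_suml; apply: eq_bigr => w _; rewrite odds.
  by rewrite mulr_natr -sumr_const; apply: eq_bigr => w _; rewrite odds.
rewrite !sigmaE eqxx /= oppr0 expR0 !mul1r => e.
have S0 : 0 < \sum_w syl w.
  case/card_gt0P: V_gt0 => w _; rewrite (bigD1 w) //= ltr_pwDl //.
    by have := syl_bnd w; lra.
  by apply: sumr_ge0 => u _; have := syl_bnd u; lra.
have {e} := mulfI (lt0r_neq0 S0) e.
have : expR (-1) < 1 :> R by rewrite expR_lt1; lra.
have m0 : 0 <= #|V|%:R :> R by [].
have := expR_gt0 (-1 : R); move: (expR _) #|V|%:R m0 => y m m0 y0 y1 e.
(* Cross-multiplication gives [y * (1 + m) = 1 + y * m], that is [y = 1], against [y < 1]. *)
have := congr1 (fun z => z * ((1 + y * m) * (1 + m))) e.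
have p1 : 0 < 1 + y * m by rewrite ltr_pwDl // mulr_ge0 // ltW.
have -> : y / (1 + y * m) * ((1 + y * m) * (1 + m)) = y * (1 + m).
  by field; rewrite gt_eqF.
have -> : (1 + m)^-1 * ((1 + y * m) * (1 + m)) = 1 + y * m.
  by field; rewrite gt_eqF //; lra.
lra.
Qed.

(** In both triples [a] and [b] have the same sign, so the weight [b / a] of [G / H] is positive. *)
Lemma readability_coefs_ratio_gt0 (R : realType) (a b c : R) :
  readability_coefs a b c -> 0 < b / a.
Proof.
by case=> -[-> -> _]; rewrite ?invrN ?mulrNN; apply: divr_gt0; lra.
Qed.

Theorem proposition5 (R : realType) (V : finType) (smax : R) (syl : V -> R)
    (a b c dflt : R) (K : nat)
    (beta : 'M[R]_(K, #|{: token V}|)) (bias : 'cV[R]_(#|{: token V}|))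
    (V_gt0 : (0 < #|V|)%N)
    (syl_bnd : forall w, 1 <= syl w <= smax)
    (coefs : readability_coefs a b c) :
  let e (M : 'cV[R]_K -> token V -> R) theta := eos_rate (M theta) in
  let sigma (M : 'cV[R]_K -> token V -> R) theta := syl_rate syl (M theta) in
  let Phi M theta := outer_form a b c (e M theta) (sigma M theta) in
  let model := softmax_model beta bias in
  let l := logit beta bias in
  [/\ (* softmax model: e, sigma and the almost sure long-text limit *)
      forall theta, simplex R K theta ->
        [/\ e model theta = expR (l theta eos) / \sum_v expR (l theta v),
            sigma model theta =
              (\sum_(w : V) syl w * expR (l theta (Some w)))
                / \sum_v expR (l theta v)
          & long_text_limit syl a b c dflt (model theta) (Phi model theta)],
      (* admixture models: same outer form, with e and sigma linear *)
      forall B : 'I_K -> token V -> R, (forall k, is_distribution (B k)) ->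
      let q := admixture_q B in
      let s := admixture_s syl B in
      forall theta, simplex R K theta ->
        [/\ e (admixture_model B) theta = dotv q theta,
            sigma (admixture_model B) theta = dotv s theta
          & 0 < dotv q theta < 1 ->
            long_text_limit syl a b c dflt (admixture_model B theta)
              (outer_form a b c (dotv q theta) (dotv s theta))],
      (* softmax model: e and sigma are not linear and the admixture formula
         does not apply, unless the model is degenerate (constant) *)
      [/\ nonconstant_on_simplex model ->
            ~ linear_on_simplex (e model) /\
            ~ admixture_formula_applies a b c (Phi model)
        & nonconstant_on_simplex (sigma model) ->
            ~ linear_on_simplex (sigma model)]
    & (* non-degenerate parameters exist as soon as there are two topics *)
      (1 < K)%N ->
      exists (beta' : 'M[R]_(K, #|{: token V}|))
             (bias' : 'cV[R]_(#|{: token V}|)),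
        let model' := softmax_model beta' bias' in
        [/\ ~ linear_on_simplex (e model'),
            ~ linear_on_simplex (sigma model')
          & ~ admixture_formula_applies a b c (Phi model')]].
Proof.
move=> e sigma Phi model l.
have ba0 := readability_coefs_ratio_gt0 coefs.
split.
- move=> theta _; split.
  + exact: softmax_modelE.
  + rewrite /sigma /syl_rate mulr_suml; apply: eq_bigr => w _.
    by rewrite /model softmax_modelE mulrC mulrA.
  + apply: long_text_limit_outer_form; exact: softmax_model_eos_bounds.
- move=> B _ q s theta _; split.
  + exact: eos_rate_admixture.
  + exact: syl_rate_admixture.
  + rewrite -eos_rate_admixture -syl_rate_admixture => q01.
    exact: long_text_limit_outer_form.
- split=> h; last exact: (softmax_syl_nonlinear V_gt0 syl_bnd h).
  split; first exact: (softmax_eos_nonlinear V_gt0 h).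
  exact: (softmax_admixture_formula_fails V_gt0 syl_bnd ba0 h).
- move=> K1.
  have [beta' [bias' h]] := syl_rate_nonconstant_exists V_gt0 syl_bnd K1.
  exists beta', bias'.
  (* A nonconstant sigma forces a nonconstant model, so a single example serves all three claims. *)
  have h' : nonconstant_on_simplex (softmax_model beta' bias').
    case: h => th [th' [s1 s2 ne]]; exists th, th'; split=> // eq_model.
    by apply: ne; rewrite eq_model.
  split.
  + exact: (softmax_eos_nonlinear V_gt0 h').
  + exact: (softmax_syl_nonlinear V_gt0 syl_bnd h).
  + exact: (softmax_admixture_formula_fails V_gt0 syl_bnd ba0 h').
Qed.
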